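(* For $0 \leq k \leq n$ and $n \geq 2$, $$\mathrm{frst}(n,k) = \mathrm{frst}(n-1,k-1) + \mathrm{frst}(n-1,k) \quad \text{if } k \text{ is even},$$ $$\mathrm{frst}(n,k) = \mathrm{frst}(n-2,k-2) + \mathrm{frst}(n-2,k-1) + \mathrm{frst}(n-2,k) \quad \text{if } k \text{ is odd},$$ and moreover $\mathrm{frst}(0,0)=\mathrm{frst}(1,0)=\mathrm{frst}(1,1)=1$.
   Context: A weak partition is a finite non-decreasing sequence of non-negative integers; its parts are its entries, and the multiplicity of a value is the number of entries equal to it. For $0 \leq k \leq n$, $\mathrm{frst}(n,k)$ is the number of weak partitions with exactly $n-k$ parts, each part at most $k$, such that: (a) if $k$ is even, each odd part has even multiplicity; (b) if $k$ is odd, each even part (including $0$) has even multiplicity. By convention $\mathrm{frst}(n,k)=0$ whenever $k>n$, $k<0$ or $n<0$. *)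

(* Defs.v *)
From mathcomp Require Import all_boot all_order all_algebra.

Set Implicit Arguments.
Unset Strict Implicit.
Unset Printing Implicit Defensive.

Definition weak_partition (s : seq nat) : bool := sorted leq s.

Definition multiplicity (v : nat) (s : seq nat) : nat := count_mem v s.

Definition parity_condition (k : nat) (s : seq nat) : bool :=
  if odd k then all (fun v => ~~ odd v ==> ~~ odd (multiplicity v s)) s
  else all (fun v => odd v ==> ~~ odd (multiplicity v s)) s.

(* A part at most [k] is an element of ['I_k.+1]. *)
Definition frst_set (n k : nat) : {set (n - k).-tuple 'I_k.+1} :=
  [set t : (n - k).-tuple 'I_k.+1 |
    let s := [seq nat_of_ord i | i <- t] in
    weak_partition s && parity_condition k s].

(* The arguments are integers so that [k - 1] and [k - 2] can be negative:
   truncated subtraction would turn [frst (n - 2) (-1) = 0] into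
   [frst (n - 2) 0]. *)
Definition frst (n k : int) : nat :=
  match n, k with
  | Posz n', Posz k' => if k' <= n' then #|frst_set n' k'| else 0
  | _, _ => 0
  end.

(* Main.v *)
(** Write [F p K m] for the number of sorted words of length [m] over the letters [0, ..., K - 1]
   in which every letter whose parity differs from [p] has even multiplicity,
   so that [frst n k = F (odd k) (k + 1) (n - k)].
   Removing the largest letter [K], once if its multiplicity is free and twice if it must be even,
   gives [F p (K + 1) m = F p K m + F p (K + 1) (m - j)] with [j] equal to 1 or 2.
   If [K] is even, then [v |-> K - 1 - v] exchanges the two parities, so [F p K m] does not
   depend on [p].  Both recurrences are combinations of these two facts. *)
Require Import Defs.
From mathcomp Require Import all_boot all_order all_algebra.
From mathcomp Require Import zify.

Definition parity_word (p : bool) (K m : nat) (s : seq nat) : bool :=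
  [&& size s == m, all (fun v => v < K) s, sorted leq s &
      all (fun v => (odd v != p) ==> ~~ odd (count_mem v s)) s].

(** The tuples are mapped to plain sequences so that words with different [K] and [m] share one type
    and can be compared. *)
Definition parity_words (p : bool) (K m : nat) : seq (seq nat) :=
  [seq map val (tval t) |
     t <- enum [set t : m.-tuple 'I_K | parity_word p K m (map val t)]].

Definition parity_count (p : bool) (K m : nat) : nat :=
  size (parity_words p K m).

(** Evenness extends from the letters of [s] to all [v], since an absent letter has multiplicity
    0. *)
Lemma parity_wordP p K m s :
  reflect [/\ size s = m, forall v, v \in s -> v < K, sorted leq s &
              forall v, odd v != p -> ~~ odd (count_mem v s)]
          (parity_word p K m s).
Proof.
apply: (iffP and4P) => [[/eqP szs /allP ltK sorted_s /allP even_s] |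
                        [szs ltK sorted_s even_s]]; split=> //.
- move=> v odd_v; have [v_in|/count_memPn -> //] := boolP (v \in s).
  exact: (implyP (even_s v v_in)).
- exact/eqP.
- exact/allP.
- by apply/allP => v _; apply/implyP/even_s.
Qed.

Lemma mem_parity_words p K m s :
  (s \in parity_words p K m) = parity_word p K m s.
Proof.
apply/mapP/idP => [[t]|ws]; first by rewrite mem_enum inE => wt ->.
case/parity_wordP: (ws) => szs ltK _ _.
have valK : map val (pmap insub s : seq 'I_K) = s.
  rewrite (pmap_filter (@insubK _ _ _)); apply/all_filterP/allP => v /ltK.
  by rewrite isSome_insub.
have szt : size (pmap insub s : seq 'I_K) == m by rewrite -(size_map val) valK szs.
by exists (Tuple szt); rewrite ?mem_enum ?inE /= valK.
Qed.

Lemma parity_words_uniq p K m : uniq (parity_words p K m).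
Proof.
rewrite map_inj_uniq ?enum_uniq // => t u /(inj_map val_inj).
exact: val_inj.
Qed.

Lemma sorted_cat_nseq K j s :
  sorted leq s -> (forall v, v \in s -> v <= K) -> sorted leq (s ++ nseq j K).
Proof.
rewrite !(sorted_pairwise leq_trans) pairwise_cat => -> leK /=.
apply/andP; split.
  by apply/allrelP => v w v_in /nseqP[-> _]; apply: leK.
by elim: j => //= j ->; rewrite andbT; apply/allP => w /nseqP[->].
Qed.

(** Both sides are sorted and are permutations of each other, hence equal. *)
Lemma sorted_split_max K s : sorted leq s -> (forall v, v \in s -> v <= K) ->
  s = [seq v <- s | v != K] ++ nseq (count_mem K s) K.
Proof.
move=> sorted_s leK; apply: (sorted_eq leq_trans anti_leq) => //.
  apply: sorted_cat_nseq; first exact: sorted_filter leq_trans _ _ sorted_s.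
  by move=> v; rewrite mem_filter => /andP[_ /leK].
rewrite -(perm_filterC (predC1 K)) perm_cat2l.
rewrite (eq_filter (a2 := pred1 K)); last by move=> v /=; rewrite negbK.
by rewrite -size_filter -(all_pred1P _ _ (filter_all _ _)).
Qed.

(** Here [j] is the least positive multiplicity allowed for [K]. The guard [j <= m] keeps truncated
    subtraction from extending the empty word when [m < j]. *)
Lemma parity_wordS p K m s (j := (odd K != p).+1) :
  parity_word p K.+1 m s =
    parity_word p K m s ||
    (j <= m) && (s \in map (cat^~ (nseq j K)) (parity_words p K.+1 (m - j))).
Proof.
(* Adding or removing [j] copies of [K] preserves the parity of every constrained multiplicity: if
   [K] itself is constrained, [j] is 2. *)
have even_j v : odd v != p -> odd ((K == v) * j) = false.
  move=> odd_v; rewrite oddM /j; case: eqVneq => //= ->; by rewrite odd_v.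
apply/idP/orP => [/parity_wordP[szs ltK sorted_s even_s] | [/parity_wordP[szs ltK sorted_s even_s] |]].
- have def_s := sorted_split_max _ _ sorted_s ltK.
  have [c0|c_gt0] := posnP (count_mem K s).
    left; apply/parity_wordP; split=> // v v_in.
    have := ltK v v_in; rewrite ltnS leq_eqVlt => /orP[/eqP eq_vK|//].
    by move: v_in; rewrite eq_vK -has_pred1 has_count c0.
  right; have le_jc : j <= count_mem K s.
    rewrite /j; case: eqP c_gt0 => //= /eqP/even_s.
    by case: (count_mem K s) => [|[]].
  have le_jm : j <= m by rewrite -szs (leq_trans le_jc) ?count_size.
  rewrite le_jm /=; move: def_s; set s1 := filter _ _ => def_s.
  have [s2 def_s2] : exists s2, s = s2 ++ nseq j K.
    by exists (s1 ++ nseq (count_mem K s - j) K); rewrite -catA -nseqD subnK.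
  apply/mapP; exists s2 => //.
  rewrite mem_parity_words; apply/parity_wordP; split.
  + by rewrite -szs def_s2 size_cat size_nseq addnK.
  + by move=> v v_in; apply: ltK; rewrite def_s2 mem_cat v_in.
  + by move: sorted_s; rewrite def_s2 => /cat_sorted2[].
  + move=> v odd_v; have := even_s v odd_v.
    by rewrite def_s2 count_cat count_nseq oddD even_j // addbF.
- by apply/parity_wordP; split=> // v /ltK /ltnW.
- case/andP=> le_jm /mapP[s2]; rewrite mem_parity_words.
  case/parity_wordP=> szs2 ltK sorted_s2 even_s2 ->.
  apply/parity_wordP; split.
  + by rewrite size_cat size_nseq szs2 subnK.
  + by move=> v; rewrite mem_cat => /orP[/ltK //|/nseqP[->]].
  + exact: sorted_cat_nseq.
  + by move=> v odd_v; rewrite count_cat count_nseq oddD even_j // addbF even_s2.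
Qed.

Lemma parity_countS p K m (j := (odd K != p).+1) :
  parity_count p K.+1 m =
    parity_count p K m + (if j <= m then parity_count p K.+1 (m - j) else 0).
Proof.
pose ext := if j <= m then map (cat^~ (nseq j K)) (parity_words p K.+1 (m - j))
            else [::].
rewrite /parity_count (_ : (if _ then _ else _) = size ext); last first.
  by rewrite /ext; case: ifP; rewrite ?size_map.
rewrite -size_cat; apply/perm_size/uniq_perm.
- exact: parity_words_uniq.
(* The two families are disjoint: an extended word contains [K], as [j] is positive, and a word over
   smaller letters does not. *)
- rewrite cat_uniq parity_words_uniq /=; apply/andP; split.
    apply/hasPn => s; rewrite /ext; case: ifP => // _ /mapP[s' _ ->].
    apply/negP; rewrite /= mem_parity_words => /parity_wordP[_ ltK _ _].
    by have := ltK K; rewrite ltnn mem_cat mem_head orbT => /(_ isT).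
  rewrite /ext; case: ifP => // _; rewrite map_inj_uniq ?parity_words_uniq //.
  move=> s t /(congr1 rev) /eqP; rewrite !rev_cat eqseq_cat //.
  by case/andP=> _ /eqP/(can_inj revK).
- move=> s; rewrite mem_cat !mem_parity_words parity_wordS /ext.
  by case: ifP.
Qed.

(** Complementing letters reverses the order, so [f] also reverses the word; [K.-1] is odd when [K]
    is positive, so parities flip. Injectivity of [f] gives an inequality, and applying it to both
    [p] and [~~ p] gives equality. *)
Lemma parity_count_negb_le p K m :
  ~~ odd K -> parity_count p K m <= parity_count (~~ p) K m.
Proof.
move=> even_K; pose f s := rev [seq K.-1 - v | v <- s].
have subK s : parity_word p K m s -> {in s, forall v, v < K}.
  by case/parity_wordP.
rewrite /parity_count -(size_map f); apply: uniq_leq_size.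
  rewrite map_inj_in_uniq ?parity_words_uniq // => s t.
  rewrite !mem_parity_words => /subK ltKs /subK ltKt /(can_inj revK) eq_st.
  have invK r : {in r, forall v, v < K} ->
      [seq K.-1 - v | v <- [seq K.-1 - v | v <- r]] = r.
    by move=> ltK; rewrite -map_comp map_id_in // => v /ltK /=; lia.
  by rewrite -(invK s) // eq_st invK.
move=> _ /mapP[s + ->]; rewrite !mem_parity_words.
case/parity_wordP=> szs ltK sorted_s even_s; apply/parity_wordP; split.
- by rewrite size_rev size_map.
- by move=> w; rewrite mem_rev => /mapP[v /ltK v_in ->]; lia.
- rewrite rev_sorted sorted_map; apply: sub_sorted sorted_s => v w /=; lia.
- move=> w odd_w; rewrite count_rev count_map.
  have [ltwK|leKw] := ltnP w K.
    rewrite (eq_in_count (a2 := pred1 (K.-1 - w))).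
      by apply: even_s; move: odd_w even_K ltwK; case: (p); lia.
    by move=> v /ltK ltvK /=; apply/eqP/eqP; lia.
  rewrite (eq_in_count (a2 := pred0)) ?count_pred0 // => v /ltK ltvK /=.
  by apply/eqP; lia.
Qed.

Lemma parity_count_negb p K m :
  ~~ odd K -> parity_count (~~ p) K m = parity_count p K m.
Proof.
move=> even_K; apply/eqP; rewrite eqn_leq.
by rewrite -{2}(negbK p) !parity_count_negb_le.
Qed.

Lemma parity_count0l p m : parity_count p 0 m = (m == 0).
Proof.
have words0 s : s \in parity_words p 0 m -> m == 0 /\ s = [::].
  rewrite mem_parity_words => /parity_wordP[<- lt0 _ _].
  by case: s lt0 => [|v s] // /(_ v); rewrite mem_head => /(_ isT).
have [m0|m_neq0] := eqVneq m 0.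
  apply: (@perm_size _ _ [:: [::]]); apply: uniq_perm; rewrite ?parity_words_uniq //.
  move=> s; rewrite inE; apply/idP/eqP => [/words0[]//|->].
  by rewrite mem_parity_words /parity_word m0.
rewrite /parity_count; case: parity_words words0 => // s L /(_ s).
by rewrite mem_head (negPf m_neq0) => /(_ isT)[].
Qed.

Lemma frstE (n k : nat) :
  frst n k = if k <= n then parity_count (odd k) k.+1 (n - k) else 0.
Proof.
rewrite /frst; case: ifP => // _.
rewrite /parity_count size_map -cardE; apply: eq_card => t.
rewrite !inE /parity_word /weak_partition /parity_condition /multiplicity.
rewrite size_map size_tuple eqxx /=.
have -> : all (fun v => v < k.+1) [seq nat_of_ord i | i <- t].
  by apply/allP => _ /mapP[i _ ->]; apply: ltn_ord.
case: (odd k) => /=; congr (_ && _); apply: eq_all => v.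
  by case: (odd v).
by case: (odd v).
Qed.

Theorem theorem3p3 :
  (forall n k : int, (0 <= k)%R -> (k <= n)%R -> (2 <= n)%R ->
     ((2 %| k)%Z ->
        frst n k = frst (n - 1)%R (k - 1)%R + frst (n - 1)%R k) /\
     (~~ (2 %| k)%Z ->
        frst n k = frst (n - 2)%R (k - 2)%R + frst (n - 2)%R (k - 1)%R
                   + frst (n - 2)%R k)) /\
  [/\ frst 0%Z 0%Z = 1, frst 1%Z 0%Z = 1 & frst 1%Z 1%Z = 1].
Proof.
have cS_free p K m : odd K = p -> parity_count p K.+1 m =
    parity_count p K m + (if 0 < m then parity_count p K.+1 m.-1 else 0).
  by move=> <-; rewrite parity_countS eqxx subn1.
have cS_even p K m : odd K = ~~ p -> parity_count p K.+1 m =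
    parity_count p K m + (if 1 < m then parity_count p K.+1 (m - 2) else 0).
  by move=> odd_K; rewrite parity_countS odd_K; case: p odd_K.
split; last first.
  split; rewrite frstE ?subnn ?subn0 /=.
  - by rewrite parity_countS /= parity_count0l.
  - by rewrite 2!parity_countS /= !parity_count0l.
  - by rewrite 2!parity_countS /= !parity_count0l.
case=> [n|//] [k|//] _ le_kn n_ge2.
have {}le_kn : k <= n by lia.
have {}n_ge2 : 1 < n by lia.
have -> : (n%:Z - 1)%R = n.-1 by lia.
have -> : (n%:Z - 2)%R = n.-2 by lia.
have -> : (2 %| Posz k)%Z = ~~ odd k by lia.
split=> [even_k | /negPn odd_k].
- rewrite (frstE n) le_kn cS_free // (negPf even_k); congr (_ + _).
    (* For [k = 0] the term at [k - 1] is 0, matching the absence of nonempty words over no letters.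
       Otherwise the alphabet size is even and the parity can be switched. *)
    case: k le_kn even_k => [|k] le_kn even_k.
      by rewrite parity_count0l (_ : (n - 0 == 0) = false) //; lia.
    have -> : (k.+1%:Z - 1)%R = k by lia.
    have odd_k : odd k by rewrite -[odd k]negbK.
    rewrite frstE odd_k ifT -1?(parity_count_negb false) //; last by lia.
    by congr parity_count; lia.
  rewrite frstE (negPf even_k) (_ : (k <= n.-1) = (0 < n - k)); last by lia.
  by case: ifP => // _; congr parity_count; lia.
- have even_Sk : ~~ odd k.+1 by rewrite /= odd_k.
  (* Switching the parity over the even alphabet makes the top letter [k] constrained, so it is
     removed in pairs; the next letter [k - 1] is then free and is removed singly. *)
  rewrite (frstE n) le_kn odd_k -(parity_count_negb true) //.
  rewrite cS_even //; congr (_ + _).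
    case: k le_kn odd_k even_Sk => [//|k] le_kn odd_Sk _.
    have even_k : ~~ odd k by [].
    rewrite cS_free ?(negPf even_k) //; congr (_ + _).
      (* The original index is now [k.+1]; when it is 1, the term at index -1 vanishes, as do words
         of positive length over no letters. *)
      case: k le_kn odd_Sk even_k => [|k] le_kn odd_Sk even_k.
        by rewrite parity_count0l (_ : (n - 1 == 0) = false) //; lia.
      have -> : (k.+2%:Z - 2)%R = k by lia.
      have odd_k : odd k by rewrite -[odd k]negbK.
      rewrite frstE odd_k ifT -1?(parity_count_negb false) //; last by lia.
      by congr parity_count; lia.
    have -> : (k.+1%:Z - 1)%R = k by lia.
    rewrite frstE (negPf even_k) (_ : (k <= n.-2) = (0 < n - k.+1)); last by lia.
    by case: ifP => // _; congr parity_count; lia.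
  rewrite frstE odd_k (_ : (k <= n.-2) = (1 < n - k)); last by lia.
  case: ifP => // _; rewrite (parity_count_negb true) //.
  by congr parity_count; lia.
Qed.
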